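(* The parameterized problem \textsc{Linear Ordering Above Tight Lower Bound} (LOALB) admits a kernel with $O(k^2)$ arcs; that is, there is a polynomial-time algorithm that maps any instance $(D,k)$ of LOALB to an equivalent instance $(D',k')$ of LOALB with $k'\le k$ in which $D'$ has $O(k^2)$ arcs.
   Context: LOALB: Instance: a digraph $D=(V,A)$ (no loops or parallel arcs) in which each arc $ij$ has a positive integral weight $w_{ij}$, and a positive integer $k$. Parameter: $k$. Question: is there an acyclic subdigraph of $D$ of total arc weight at least $W/2+k$, where $W=\sum_{ij\in A}w_{ij}$? Two instances are equivalent if both are yes-instances or both are no-instances. *)

(* Defs.v *)
From mathcomp Require Import all_boot all_order all_algebra.

Set Implicit Arguments.
Unset Strict Implicit.
Unset Printing Implicit Defensive.

Import GRing.Theory Num.Theory.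

(* Vertices are labelled 0, ..., n-1, so that a digraph can be written down as
   the input of a program.  Values of [weight] off [arcs] are irrelevant: they
   enter neither the problem nor its encoding. *)
Record wdigraph := WDigraph {
  nvert : nat;
  arcs : {set 'I_nvert * 'I_nvert};
  weight : 'I_nvert * 'I_nvert -> nat;
  arcs_loopless : forall i, (i, i) \notin arcs;
  weight_gt0 : forall a, a \in arcs -> 0 < weight a }.

Definition arcs_weight (D : wdigraph) (B : {set 'I_(nvert D) * 'I_(nvert D)}) :
    nat :=
  \sum_(a in B) weight a.

(* No directed cycle.  2-cycles count, since [x; y] with both arcs present is a
   [ucycle]. *)
Definition acyclic (n : nat) (B : {set 'I_n * 'I_n}) : Prop :=
  forall c : seq 'I_n, ucycle [rel i j | (i, j) \in B] c -> c = [::].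

Record instance := Instance {
  graph : wdigraph;
  param : nat;
  param_gt0 : 0 < param }.

(* A subdigraph is given by its arc set; its vertex set affects neither its
   weight nor its acyclicity. *)
Definition yes_instance (I : instance) : Prop :=
  exists B : {set 'I_(nvert (graph I)) * 'I_(nvert (graph I))},
    [/\ B \subset arcs (graph I), acyclic B
      & ((arcs_weight (arcs (graph I)))%:R / 2%:R + (param I)%:R
           <= (arcs_weight B)%:R :> rat)%R].

Definition equivalent (I J : instance) : Prop :=
  yes_instance I <-> yes_instance J.

(* Model of computation: the WHILE language on binary trees (N. D. Jones,
   Computability and Complexity from a Programming Perspective, 1997).  Building
   or reading a tree is charged its full size rather than one unit, so a
   computation of cost t from an input of size m never stores more than m + t
   tree nodes besides the initial leaves, and it is simulated by a
   Turing machine in time polynomial in m + t. *)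
Inductive tree := Leaf | Node of tree & tree.

Fixpoint tsize (t : tree) : nat :=
  if t is Node l r then (tsize l + tsize r).+1 else 1.

Definition is_node (t : tree) : bool := if t is Node _ _ then true else false.

Inductive expr :=
  | EVar of nat
  | ELeaf
  | ENode of expr & expr
  | ELeft of expr
  | ERight of expr.

Inductive cmd :=
  | CAssign of nat & expr
  | CSeq of cmd & cmd
  | CIf of expr & cmd & cmd
  | CWhile of expr & cmd.

Definition store := nat -> tree.

Definition update (s : store) (x : nat) (t : tree) : store :=
  fun y => if y == x then t else s y.

Fixpoint eval (s : store) (e : expr) : tree :=
  match e with
  | EVar x => s x
  | ELeaf => Leaf
  | ENode e1 e2 => Node (eval s e1) (eval s e2)
  | ELeft e1 => if eval s e1 is Node l _ then l else Leaf
  | ERight e1 => if eval s e1 is Node _ r then r else Leaf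
  end.

Fixpoint ecost (s : store) (e : expr) : nat :=
  tsize (eval s e) +
  match e with
  | EVar _ | ELeaf => 0
  | ENode e1 e2 => ecost s e1 + ecost s e2
  | ELeft e1 | ERight e1 => ecost s e1
  end.

(* [exec c s s' t]: started in s, the command c halts in s' after time t. *)
Inductive exec : cmd -> store -> store -> nat -> Prop :=
  | ExecAssign x e s :
      exec (CAssign x e) s (update s x (eval s e)) (ecost s e)
  | ExecSeq c1 c2 s s1 s2 t1 t2 :
      exec c1 s s1 t1 -> exec c2 s1 s2 t2 ->
      exec (CSeq c1 c2) s s2 (t1 + t2)
  | ExecIfTrue e c1 c2 s s' t :
      is_node (eval s e) -> exec c1 s s' t ->
      exec (CIf e c1 c2) s s' (ecost s e + t)
  | ExecIfFalse e c1 c2 s s' t :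
      ~~ is_node (eval s e) -> exec c2 s s' t ->
      exec (CIf e c1 c2) s s' (ecost s e + t)
  | ExecWhileFalse e c s :
      ~~ is_node (eval s e) -> exec (CWhile e c) s s (ecost s e)
  | ExecWhileTrue e c s s1 s2 t1 t2 :
      is_node (eval s e) -> exec c s s1 t1 -> exec (CWhile e c) s1 s2 t2 ->
      exec (CWhile e c) s s2 (ecost s e + t1 + t2).

(* Input and output are both in variable 0. *)
Definition init_store (input : tree) : store :=
  fun x => if x == 0 then input else Leaf.

Definition enc_seq (s : seq tree) : tree := foldr Node Leaf s.

Definition enc_bit (b : bool) : tree := if b then Node Leaf Leaf else Leaf.

Fixpoint pos_bits (p : BinNums.positive) : seq bool :=
  match p with
  | BinNums.xH => [:: true]
  | BinNums.xO q => false :: pos_bits q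
  | BinNums.xI q => true :: pos_bits q
  end.

(* Binary digits, least significant first; 0 has no digits. *)
Definition nat_bits (n : nat) : seq bool :=
  if bin_of_nat n is BinNums.Npos p then pos_bits p else [::].

Definition enc_nat (n : nat) : tree := enc_seq [seq enc_bit b | b <- nat_bits n].

(* Weighted adjacency matrix, row by row, with 0 for a non-arc; weights and the
   parameter are in binary. *)
Definition enc_graph (D : wdigraph) : tree :=
  enc_seq [seq enc_seq [seq enc_nat (if (i, j) \in arcs D then weight (i, j) else 0)
                       | j <- enum 'I_(nvert D)]
          | i <- enum 'I_(nvert D)].

Definition enc_instance (I : instance) : tree :=
  Node (enc_graph (graph I)) (enc_nat (param I)).

Definition poly_time (f : instance -> instance) : Prop :=
  exists (c : cmd) (a d : nat), forall I : instance,
    exists (s : store) (t : nat),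
      [/\ exec c (init_store (enc_instance I)) s t,
          s 0 = enc_instance (f I)
        & t <= a * tsize (enc_instance I) ^ d + a].

(* Main.v *)
From Pilot Require Import Defs.
From mathcomp Require Import all_boot all_order all_algebra.
From mathcomp Require Import zify ring lra.
(* [tuple.tsize] hides [Defs.tsize] otherwise. *)
Import Pilot.Defs.

Set Implicit Arguments.
Unset Strict Implicit.
Unset Printing Implicit Defensive.

Import GRing.Theory Num.Theory Order.TTheory.

(** Only the differences [s i j = w_ij - w_ji] matter: an acyclic subdigraph
    extends to the forward arcs of a linear order [l], and twice their weight
    exceeds the total weight by [surplus l], the sum of [s i j] over all [i]
    before [j] in [l].  So deleting every pair of opposite arcs of equal weight
    gives an equivalent instance.

    Call a vertex active if [s i j != 0] for some [j].  Some order has surplus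
    at least a quarter of the number of active vertices: take [a], [b] with
    [s a b != 0] and let [L] be the remaining vertices that are isolated once
    [a] and [b] are gone.  Each active vertex of [L] can be inserted so as to
    gain, in total over the orders [ab] and [ba], at least 1; so the block
    [a, b, L] has an order of surplus at least a quarter of its number of
    active vertices.  Put the block before or after an order of the rest,
    whichever makes the cross terms nonnegative; the order of the rest comes
    from the same construction.

    Hence [8 k] active vertices make a yes-instance, and otherwise the reduced
    digraph has fewer than [(8 k)^2] arcs.  The program compares the number of
    active vertices with [8 * 2^b], where [b] is the number of binary digits of
    [k] and so [k < 2^b <= 2 k], by repeated halving. *)

(** * Linear orders of large surplus *)

Section Surplus.

Local Open Scope ring_scope.

Variables (T : eqType) (s : T -> T -> int).
Hypothesis s_anti : forall x y, s x y = - s y x.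

Fixpoint surplus (l : seq T) : int :=
  if l is x :: l' then \sum_(y <- l') s x y + surplus l' else 0.

Lemma surplus_cat (p q : seq T) :
  surplus (p ++ q) = surplus p + surplus q + \sum_(x <- p) \sum_(y <- q) s x y.
Proof.
elim: p => [|x p IH] /=; first by rewrite big_nil addr0 add0r.
by rewrite IH big_cons big_cat /=; ring.
Qed.

Lemma surplus_insert (u : T) (p q : seq T) :
  surplus (p ++ u :: q) =
  surplus (p ++ q) + \sum_(x <- p) s x u + \sum_(y <- q) s u y.
Proof.
rewrite !surplus_cat /=.
have -> : \sum_(x <- p) \sum_(y <- u :: q) s x y =
    \sum_(x <- p) s x u + \sum_(x <- p) \sum_(y <- q) s x y.
  by rewrite -big_split; apply: eq_bigr => x _; rewrite big_cons.
by ring.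
Qed.

Lemma cross_anti (p q : seq T) :
  \sum_(x <- p) \sum_(y <- q) s x y = - \sum_(x <- q) \sum_(y <- p) s x y.
Proof.
rewrite exchange_big /= -sumrN; apply: eq_bigr => y _.
by rewrite -sumrN; apply: eq_bigr => x _; apply: s_anti.
Qed.

(** The cross terms of [p ++ q] and of [q ++ p] are opposite, so one of the two is nonnegative. *)
Lemma surplus_catC_max (p q : seq T) :
  exists2 l, perm_eq l (p ++ q) & surplus p + surplus q <= surplus l.
Proof.
have := cross_anti p q; set c := \sum_(x <- p) _; set d := \sum_(x <- q) _.
move=> cd; case: (lerP 0 c) => c0.
  by exists (p ++ q) => //; rewrite surplus_cat -/c; lia.
exists (q ++ p); first by rewrite perm_catC.
by rewrite surplus_cat -/d; lia.
Qed.

(* The three alternatives for [m u] are the effects of putting [u] before [a],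
   between [a] and [b], and after [b]. *)
Lemma surplus_insert_indep (a b : T) (m : T -> int) (L : seq T) :
    {in L &, forall u v, s u v = 0} ->
    {in L, forall u, [\/ m u <= - s a u - s b u, m u <= s a u - s b u
                       | m u <= s a u + s b u]} ->
  exists2 l, perm_eq l (a :: b :: L) & s a b + \sum_(u <- L) m u <= surplus l.
Proof.
move=> indep mP.
(* [L1], [L2] and [L3] collect the vertices inserted before [a], between [a] and [b], and after [b].
   As [s] vanishes on [L], an inserted vertex interacts only with [a] and [b]. *)
suff [L1 [L2 [L3 [pL le_m]]]] : exists L1 L2 L3, perm_eq (L1 ++ L2 ++ L3) L /\
    s a b + \sum_(u <- L) m u <= surplus (L1 ++ a :: L2 ++ b :: L3).
  exists (L1 ++ a :: L2 ++ b :: L3) => //.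
  by apply/permP => P; have := permP pL P; do 3 rewrite /= ?count_cat; lia.
elim: L indep mP => [|u L IH] indep mP.
  exists [::], [::], [::]; split => //=.
  by rewrite !big_nil big_cons big_nil; lia.
have subL x : x \in L -> x \in u :: L by move=> xL; rewrite inE xL orbT.
have [||L1 [L2 [L3 [pL le_m]]]] := IH.
- by move=> x y /subL xL /subL yL; apply: indep.
- by move=> x /subL; apply: mP.
have memL x : x \in L1 ++ L2 ++ L3 -> s u x = 0.
  by rewrite (perm_mem pL) => /subL xL; apply: indep; rewrite ?mem_head.
have sum0 (K : seq T) : {subset K <= L1 ++ L2 ++ L3} ->
    \sum_(x <- K) s u x = 0.
  by move=> KL; rewrite big_seq big1 // => x /KL /memL.
have sum0' (K : seq T) : {subset K <= L1 ++ L2 ++ L3} ->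
    \sum_(x <- K) s x u = 0.
  by move=> KL; rewrite big_seq big1 // => x /KL /memL ux; rewrite s_anti ux oppr0.
have sub1 : {subset L1 <= L1 ++ L2 ++ L3} by move=> x xL; rewrite !mem_cat xL.
have sub2 : {subset L2 <= L1 ++ L2 ++ L3}.
  by move=> x xL; rewrite !mem_cat xL orbT.
have sub3 : {subset L3 <= L1 ++ L2 ++ L3}.
  by move=> x xL; rewrite !mem_cat xL !orbT.
have ua := s_anti u a; have ub := s_anti u b.
rewrite big_cons; set M := \sum_(j <- L) m j in le_m *.
have [hm|hm|hm] := mP u (mem_head _ _).
- exists (u :: L1), L2, L3; split; first by rewrite /= perm_cons.
  rewrite /= !(big_cat, big_cons) /= !sum0 //; lia.
- exists L1, (u :: L2), L3; split.
    by apply/permP => P; have := permP pL P; do 3 rewrite /= ?count_cat; lia.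
  rewrite -cat_rcons cat_cons surplus_insert cat_rcons -cats1.
  rewrite !(big_cat, big_cons, big_nil) /= !(sum0, sum0') //; lia.
- exists L1, L2, (u :: L3); split.
    by apply/permP => P; have := permP pL P; do 3 rewrite /= ?count_cat; lia.
  have e (K : seq T) : L1 ++ a :: L2 ++ b :: K = (L1 ++ a :: rcons L2 b) ++ K.
    by rewrite -catA /= cat_rcons.
  rewrite e surplus_insert -e -cats1.
  rewrite !(big_cat, big_cons, big_nil) /= !(sum0, sum0') //; lia.
Qed.

Lemma count_sum_int (P : pred T) (l : seq T) :
  (count P l)%:Z = \sum_(u <- l) (P u)%:Z.
Proof.
by elim: l => [|x l IH]; rewrite ?big_nil //= big_cons PoszD IH.
Qed.

Lemma surplus_block (a b : T) (L : seq T) :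
    s a b != 0 -> {in L &, forall u v, s u v = 0} ->
  exists2 l, perm_eq l (a :: b :: L) &
    (2 + count (fun u => (s u a != 0) || (s u b != 0)) L)%:Z <= 4 * surplus l.
Proof.
wlog ab0 : a b / 0 < s a b.
  move=> wl ab indep; case: (ltrP 0 (s a b)) => ab0; first exact: wl.
  have [|||l pl le_l] := wl b a => //.
  - by have := s_anti a b; lia.
  - by have := s_anti a b; lia.
  exists l.
    by apply/permP => P; have := permP pl P; rewrite /=; lia.
  by under eq_count do rewrite orbC.
move=> _ indep.
pose P u := (s u a != 0) || (s u b != 0).
(* The best of the three insertions of [u] into the order [ab], and on the next line into [ba]. The
   two outer positions contribute opposite amounts, whence the absolute value. *)
pose ma u : int := Num.max `|s a u + s b u| (s a u - s b u).
pose mb u : int := Num.max `|s a u + s b u| (s b u - s a u).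
have [|l1 p1 le1] := @surplus_insert_indep a b ma L indep.
  move=> u _; rewrite /ma.
  case: (lerP `|s a u + s b u| (s a u - s b u)) => h; first by constructor 2.
  by case: (lerP 0 (s a u + s b u)) => h'; [constructor 3|constructor 1]; lia.
have [|l2 p2 le2] := @surplus_insert_indep b a mb L indep.
  move=> u _; rewrite /mb.
  case: (lerP `|s a u + s b u| (s b u - s a u)) => h; first by constructor 2.
  by case: (lerP 0 (s a u + s b u)) => h'; [constructor 3|constructor 1]; lia.
have ma0 : 0 <= \sum_(u <- L) ma u by apply: sumr_ge0 => u _; rewrite /ma; lia.
(* [ma u + mb u] is at least [2 * |s a u + s b u|], and equals [2 * |s a u|] when that sum vanishes;
   so it is positive whenever [P u]. *)
have mab : (count P L)%:Z <= \sum_(u <- L) ma u + \sum_(u <- L) mb u.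
  rewrite count_sum_int -big_split /=; apply: ler_sum => u _.
  by rewrite /ma /mb /P; have := s_anti u a; have := s_anti u b; lia.
have ba := s_anti b a.
case: (lerP (2 + count P L)%:Z (4 * surplus l1)) => h; first by exists l1.
(* Let [c = count P L]. If [l1] fails, then [4 * (s a b + \sum ma) <= c + 1]. Since [s a b >= 1],
   this forces [c >= 3], and [4 * surplus l2 >= 4 * c - (c + 1) >= c + 2]. *)
exists l2; last by rewrite -/P; lia.
by apply/permP => Q; have := permP p2 Q; rewrite /=; lia.
Qed.

Definition active (l : seq T) (x : T) : bool := has (fun y => s x y != 0) l.

Lemma surplus_active (l : seq T) :
  exists2 l', perm_eq l' l & (count (active l) l)%:Z <= 4 * surplus l'.
Proof.
have [n le_n] := ubnP (size l); elim: n => // n IH in l le_n *.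
have [/hasP[a al /hasP[b bl ab]]|noact] := boolP (has (active l) l); last first.
  exists l => //; rewrite (_ : count _ _ = 0)%N; last first.
    by apply/eqP; rewrite -leqn0 leqNgt -has_count.
  rewrite (_ : surplus l = 0) ?mulr0 //.
  have z : {in l &, forall x y, s x y = 0}.
    move=> x y xl yl; apply/eqP/negPn/negP => xy.
    by case/hasP: noact; exists x => //; apply/hasP; exists y.
  elim: l z {le_n noact} => //= x l IHl z.
  rewrite IHl => [|u v ul vl]; last by apply: z; rewrite inE ?ul ?vl orbT.
  by rewrite big_seq big1 // => y yl; apply: z; rewrite ?mem_head // inE yl orbT.
pose l0 := rem b (rem a l).
have ba : b \in rem a l.
  have : b != a by apply: contraNneq ab => ->; have := s_anti a a; lia.
  move: bl; rewrite (perm_mem (perm_to_rem al)) inE => /orP[-> //|//].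
have pl : perm_eq l (a :: b :: l0).
  by apply: perm_trans (perm_to_rem al) _; rewrite perm_cons; apply: perm_to_rem.
have sz := perm_size pl.
pose L := filter (predC (active l0)) l0; pose R := filter (active l0) l0.
have p0 : perm_eq (L ++ R) l0.
  by rewrite perm_catC; apply/permPl/perm_filterC.
have indep : {in L &, forall u v, s u v = 0}.
  move=> u v; rewrite !mem_filter => /andP[/= nu _] /andP[_ vl].
  by apply/eqP/negPn/negP => uv; case/hasP: nu; exists v.
have [lB pB leB] := surplus_block ab indep.
have [|lR pR leR] := IH R.
  by move: le_n; rewrite sz size_filter /=; have := count_size (active l0) l0; lia.
(* If [x] in [R] has [s x y != 0] with [y] in [l0], then [y] is active too and lies in [R]. So every
   vertex of [R] still counts in the recursive call. *)
have allR : count (active R) R = size R.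
  apply/eqP; rewrite -all_count; apply/allP => x.
  rewrite mem_filter => /andP[/hasP[y yl xy] xl].
  apply/hasP; exists y => //; rewrite mem_filter yl andbT.
  by apply/hasP; exists x => //; rewrite s_anti oppr_eq0.
have [l' p' le'] := surplus_catC_max lB lR.
exists l'.
  apply: perm_trans p' _; apply: perm_trans (perm_cat pB pR) _.
  by rewrite perm_sym; apply: perm_trans pl _; rewrite /= !perm_cons perm_sym.
(* A vertex of [L] is isolated within [l0], so only [a] or [b] can make it active in [l]. *)
have actL : (count (active l) L <=
    count (fun u => (s u a != 0%R) || (s u b != 0%R)) L)%N.
  rewrite (@eq_in_count _ _ (fun x => (x \in L) && active l x)) => [|x ->] //.
  apply: sub_count => x /andP[xL /hasP[y]]; rewrite (perm_mem pl) !inE.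
  case/or3P => [/eqP-> ->|/eqP-> ->|yl xy]; rewrite ?orbT //.
  by move: xL; rewrite mem_filter => /andP[/hasP[]]; exists y.
move: leB leR; rewrite allR => leB leR.
have -> : count (active l) l =
    (active l a + active l b + (count (active l) L + count (active l) R))%N.
  by rewrite -count_cat (permP p0) (permP pl) /=; lia.
have := count_size (active l) R.
lia.
Qed.

End Surplus.

(** * Acyclic subdigraphs and linear orders *)

Section Orderings.

Variable D : wdigraph.
Notation V := 'I_(nvert D).

Definition arc_weight (i j : V) : nat :=
  if (i, j) \in arcs D then weight (i, j) else 0.

Definition net (i j : V) : int :=
  ((arc_weight i j)%:Z - (arc_weight j i)%:Z)%R.

Definition forward_arcs (l : seq V) : {set V * V} :=
  [set a in arcs D | index a.1 l < index a.2 l].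

Lemma net_anti i j : net i j = (- net j i)%R.
Proof. by rewrite /net; lia. Qed.

Lemma arcs_weightE (P : rel V) :
  arcs_weight [set a in arcs D | P a.1 a.2] =
  \sum_i \sum_(j | P i j) arc_weight i j.
Proof.
rewrite /arcs_weight pair_big_dep /= [RHS]big_mkcond [LHS]big_mkcond /=.
apply: eq_bigr => -[i j] _; rewrite inE /arc_weight /=.
by case: (_ \in arcs D); case: (P i j).
Qed.

Lemma surplus_index (l : seq V) : uniq l ->
  surplus net l =
  (\sum_(i <- l) \sum_(j <- l | (index i l < index j l)%N) net i j)%R.
Proof.
elim: l => [|x l IH] /=; first by rewrite big_nil.
move=> /andP[xl ul]; rewrite IH // big_cons; congr (_ + _)%R.
  rewrite big_cons eqxx ltnn [RHS]big_seq_cond [LHS]big_seq; apply: eq_bigl => j.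
  case: (boolP (j \in l)) => //= jl.
  by case: eqVneq => // xj; rewrite xj jl in xl.
rewrite [LHS]big_seq [RHS]big_seq; apply: eq_bigr => i il.
have xi : x != i by apply: contraNneq xl => ->.
rewrite big_cons eqxx (negPf xi) ltn0 [LHS]big_seq_cond [RHS]big_seq_cond.
apply: eq_bigl => j; case: (boolP (j \in l)) => //= jl.
by have /negPf-> : x != j by apply: contraNneq xl => ->.
Qed.

(** With [F] and [B] the forward and backward weights, the total weight is [F + B] and the surplus
    is [F - B]. *)
Lemma surplus_forward (l : seq V) : perm_eq l (enum V) ->
  ((2 * arcs_weight (forward_arcs l))%N%:Z =
   surplus net l + (arcs_weight (arcs D))%:Z)%R.
Proof.
move=> pl.
have ul : uniq l by rewrite (perm_uniq pl) enum_uniq.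
have meml i : i \in l by rewrite (perm_mem pl) mem_enum.
pose lt : rel V := fun i j => index i l < index j l.
have meml2 i j : (index i l == index j l) = (i == j).
  by apply/eqP/eqP => [/index_inj-> //|->].
pose F := \sum_i \sum_(j | lt i j) arc_weight i j.
pose B := \sum_i \sum_(j | lt j i) arc_weight i j.
have FE : arcs_weight (forward_arcs l) = F by apply: arcs_weightE.
have WE : arcs_weight (arcs D) = F + B.
  transitivity (\sum_i \sum_(j | true) arc_weight i j).
    rewrite -(arcs_weightE (fun _ _ => true)); congr arcs_weight.
    by apply/setP => a; rewrite inE andbT.
  rewrite -big_split; apply: eq_bigr => i _ /=.
  rewrite (bigID (lt i)) /=; congr addn.
  rewrite (bigD1 i) /= ?/lt ?ltnn // {1}/arc_weight (negPf (arcs_loopless i)).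
  rewrite add0n; apply: eq_bigl => j.
  by rewrite -leqNgt ltn_neqAle meml2 andbC.
have sE : surplus net l = (F%:Z - B%:Z)%R.
  rewrite surplus_index // (perm_big _ pl) big_enum /=.
  have -> : B = \sum_i \sum_(j | lt i j) arc_weight j i.
    by rewrite /B (exchange_big_dep predT).
  rewrite /F !(big_morph Posz PoszD (erefl _)) -sumrB; apply: eq_bigr => i _.
  rewrite !(big_morph Posz PoszD (erefl _)) -sumrB (perm_big _ pl) big_enum_cond.
  by apply: eq_bigl.
by rewrite FE WE sE; lia.
Qed.

Lemma forward_arcs_acyclic (l : seq V) : acyclic (forward_arcs l).
Proof.
case=> // x p /andP[/= cyc _].
have lt_tr : transitive (fun i j : V => index i l < index j l).
  by move=> y x' z; apply: ltn_trans.
have pth : path (fun i j : V => index i l < index j l) x (rcons p x).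
  by apply: sub_path cyc => i j /=; rewrite inE => /andP[].
have /allP/(_ x) := order_path_min lt_tr pth.
by rewrite mem_rcons mem_head ltnn => /(_ isT).
Qed.

(** A topological sort: the vertices are sorted by the number of vertices from which they can be
    reached along [B], which strictly increases along every arc of [B]. *)
Lemma acyclic_sub_forward (B : {set V * V}) :
  B \subset arcs D -> acyclic B ->
  exists2 l, perm_eq l (enum V) & B \subset forward_arcs l.
Proof.
move=> BA acB; pose e := [rel i j | (i, j) \in B].
pose rank j := #|[set i | connect e i j]|.
have rank_lt i j : (i, j) \in B -> rank i < rank j.
  move=> ij; apply/proper_card/properP; split.
    apply/subsetP => u; rewrite !inE => ui; apply: connect_trans ui _.
    exact: connect1.
  (* The vertex [j] reaches itself but not [i]: a path from [j] to [i] would close up with the arc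
     from [i] to [j] into a cycle. *)
  exists j; rewrite !inE ?connect0 //; apply/negP => /connectP[p].
  case/shortenP => p' pth un _ lst.
  have : ucycle e (j :: p').
    by rewrite /ucycle un andbT /= rcons_path pth -lst.
  by move/acB.
pose leT := relpre rank leq.
have leT_tr : transitive leT by move=> y x z; apply: leq_trans.
have leT_tot : total leT by move=> x y; apply: leq_total.
exists (sort leT (enum V)); first by rewrite perm_sort.
apply/subsetP => -[i j] ij; rewrite inE (subsetP BA) //=.
have srt := sort_sorted leT_tot (enum V).
have mem_l u : u \in sort leT (enum V) by rewrite mem_sort mem_enum.
rewrite ltnNge leq_eqVlt; apply/negP => /orP[/eqP/index_inj ji|ji].
  by have := rank_lt _ _ ij; rewrite ji // ltnn.
have := sorted_ltn_index leT_tr srt _ _ (mem_l j) (mem_l i) ji.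
by rewrite /leT /= leqNgt rank_lt.
Qed.

End Orderings.

(** Doubling the bound [W/2 + k] and using the formula for the forward weight cancels the total
    weight and leaves a surplus of at least [2 * k]. *)
Lemma yes_instanceP (I : instance) :
  yes_instance I <->
  exists2 l, perm_eq l (enum 'I_(nvert (graph I)))
    & ((2 * param I)%N%:Z <= surplus (@net (graph I)) l)%R.
Proof.
have half_le (w k b : nat) :
    ((w%:R / 2%:R + k%:R <= b%:R :> rat)%R) = (w + 2 * k <= 2 * b).
  rewrite -(ler_nat rat) natrD !natrM.
  by apply/idP/idP => h; lra.
split=> [[B [BA acB]]|[l pl le_l]].
  rewrite half_le => le_B; have [l pl Bl] := acyclic_sub_forward BA acB.
  exists l => //; have := surplus_forward pl.
  have : arcs_weight B <= arcs_weight (forward_arcs l).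
    rewrite /arcs_weight [leqRHS](big_setID B) /=.
    by rewrite (setIidPr Bl) leq_addr.
  by lia.
exists (forward_arcs l); split.
- by apply/subsetP => a; rewrite inE => /andP[].
- exact: forward_arcs_acyclic.
- by rewrite half_le; have := surplus_forward pl; lia.
Qed.

(** * The WHILE program *)

Lemma eval_ext (s s' : store) (e : expr) : s =1 s' -> eval s e = eval s' e.
Proof. by move=> ss; elim: e => //= [e1 -> e2 ->|e1 ->|e1 ->]. Qed.

Lemma ecost_ext (s s' : store) (e : expr) : s =1 s' -> ecost s e = ecost s' e.
Proof.
by move=> ss; elim: e => /= [x||e1 -> e2 ->|e1 ->|e1 ->];
  rewrite ?ss // !(eval_ext _ ss).
Qed.

(* A store is described by the finite list of its registers, all others being
   [Leaf].  In use, [N] bounds the cost of evaluating a single expression and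
   [n] the number of expressions evaluated. *)
Definition runs (N : nat) (c : cmd) (l l' : seq tree) (n : nat) : Prop :=
  forall s : store, s =1 nth Leaf l ->
  exists (s' : store) (t : nat),
    [/\ exec c s s' t, s' =1 nth Leaf l' & t <= n * N].

Section Runs.

Variable N : nat.
Implicit Types (c : cmd) (e : expr) (l : seq tree) (n : nat).

Lemma runs_leq c l l' n n' : n <= n' -> runs N c l l' n -> runs N c l l' n'.
Proof.
move=> le_n r s sl; have [s' [t [ex s'l le_t]]] := r s sl.
by exists s', t; split=> //; apply: leq_trans le_t _; rewrite leq_mul2r le_n orbT.
Qed.

Lemma runs_assign x e l :
  ecost (nth Leaf l) e <= N ->
  runs N (CAssign x e) l (set_nth Leaf l x (eval (nth Leaf l) e)) 1.
Proof.
move=> le_e s sl; exists (update s x (eval s e)), (ecost s e); split.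
- exact: ExecAssign.
- by move=> y; rewrite nth_set_nth /= /update sl (eval_ext _ sl).
- by rewrite mul1n (ecost_ext _ sl).
Qed.

Lemma runs_seq c1 c2 l l1 l2 n1 n2 :
  runs N c1 l l1 n1 -> runs N c2 l1 l2 n2 -> runs N (CSeq c1 c2) l l2 (n1 + n2).
Proof.
move=> r1 r2 s sl; have [s1 [t1 [ex1 sl1 le1]]] := r1 s sl.
have [s2 [t2 [ex2 sl2 le2]]] := r2 s1 sl1.
exists s2, (t1 + t2); split=> //; first exact: ExecSeq ex1 ex2.
by rewrite mulnDl leq_add.
Qed.

Lemma runs_if e c1 c2 l l' n :
  ecost (nth Leaf l) e <= N ->
  runs N (if is_node (eval (nth Leaf l) e) then c1 else c2) l l' n ->
  runs N (CIf e c1 c2) l l' n.+1.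
Proof.
move=> le_e r s sl; have [s' [t [ex s'l le_t]]] := r s sl.
exists s', (ecost s e + t); split=> //.
  case: ifP ex => node ex.
    by apply: ExecIfTrue => //; rewrite (eval_ext _ sl).
  by apply: ExecIfFalse => //; rewrite (eval_ext _ sl) node.
by rewrite mulSn leq_add // (ecost_ext _ sl).
Qed.

Lemma runs_while_false e c l :
  ecost (nth Leaf l) e <= N -> ~~ is_node (eval (nth Leaf l) e) ->
  runs N (CWhile e c) l l 1.
Proof.
move=> le_e node s sl; exists s, (ecost s e); split=> //.
  by apply: ExecWhileFalse; rewrite (eval_ext _ sl).
by rewrite mul1n (ecost_ext _ sl).
Qed.

Lemma runs_while_true e c l l1 l2 n1 n2 :
  ecost (nth Leaf l) e <= N -> is_node (eval (nth Leaf l) e) ->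
  runs N c l l1 n1 -> runs N (CWhile e c) l1 l2 n2 ->
  runs N (CWhile e c) l l2 (n1 + n2).+1.
Proof.
move=> le_e node r1 r2 s sl; have [s1 [t1 [ex1 sl1 le1]]] := r1 s sl.
have [s2 [t2 [ex2 sl2 le2]]] := r2 s1 sl1.
exists s2, (ecost s e + t1 + t2); split=> //.
  by apply: ExecWhileTrue ex1 ex2; rewrite (eval_ext _ sl).
by rewrite mulSn mulnDl -addnA !leq_add // (ecost_ext _ sl).
Qed.

End Runs.

(* Text of the program *)
Declare Scope cmd_scope.
Delimit Scope cmd_scope with cmd.
Notation "x ::= e" := (CAssign x e) (at level 60) : cmd_scope.
Notation "c1 ;; c2" := (CSeq c1 c2) (at level 65, right associativity) : cmd_scope.
Notation "''V' x" := (EVar x) (at level 8, format "''V' x").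

(* Registers: 0 input and output; 1 rows still to be processed; 2 all rows, with
   the entries in processed columns removed, so that their heads form the
   current column; 3 processed rows, last first; 4 number of active vertices in
   unary; 5 rest of the current row; 6 rows of register 2 still to be read; 7 the
   rows already read, without their heads, last first; 8 new row, last entry
   first; 9 whether the current vertex is active; 10 to 12 arguments and results
   of [rev_code] and [neq_code].  In [half_code], 5 counts the halvings of
   register 4 and 6 collects the half. *)
Definition rev_code : cmd :=
  (11 ::= ELeaf ;;
   CWhile 'V 10
     (11 ::= ENode (ELeft 'V 10) 'V 11 ;;
      10 ::= ERight 'V 10))%cmd.

(** Assigning register 12 to itself acts as a no-op. The test after the loop catches a second digit
    list longer than the first. *)
Definition neq_code : cmd :=
  (CWhile 'V 10
     (CIf 'V 11
        (CIf (ELeft 'V 10)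
           (CIf (ELeft 'V 11) (12 ::= 'V 12) (12 ::= ENode ELeaf ELeaf))
           (CIf (ELeft 'V 11) (12 ::= ENode ELeaf ELeaf) (12 ::= 'V 12)))
        (12 ::= ENode ELeaf ELeaf) ;;
      10 ::= ERight 'V 10 ;;
      11 ::= ERight 'V 11) ;;
   CIf 'V 11 (12 ::= ENode ELeaf ELeaf) (12 ::= 'V 12) ;;
   11 ::= ELeaf)%cmd.

(** Walks along row [i] in register 5 and, through the heads of the rows in register 6, down column
    [i], so that the weights of [ij] and [ji] meet. Equal weights are replaced by [Leaf], the
    encoding of 0. *)
Definition row_code : cmd :=
  CWhile 'V 6
    (10 ::= ELeft 'V 5 ;;
     11 ::= ELeft (ELeft 'V 6) ;;
     neq_code ;;
     CIf 'V 12
       (8 ::= ENode (ELeft 'V 5) 'V 8 ;; 9 ::= 'V 12)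
       (8 ::= ENode ELeaf 'V 8) ;;
     12 ::= ELeaf ;;
     7 ::= ENode (ERight (ELeft 'V 6)) 'V 7 ;;
     5 ::= ERight 'V 5 ;;
     6 ::= ERight 'V 6)%cmd.

Definition matrix_code : cmd :=
  CWhile 'V 1
    (5 ::= ELeft 'V 1 ;;
     6 ::= 'V 2 ;;
     row_code ;;
     10 ::= 'V 7 ;; 7 ::= ELeaf ;; rev_code ;; 2 ::= 'V 11 ;;
     10 ::= 'V 8 ;; 8 ::= ELeaf ;; rev_code ;; 3 ::= ENode 'V 11 'V 3 ;;
     11 ::= ELeaf ;;
     CIf 'V 9 (4 ::= ENode ELeaf 'V 4) (4 ::= 'V 4) ;;
     9 ::= ELeaf ;;
     1 ::= ERight 'V 1)%cmd.

(** The inner test asks for at least two remaining elements, so halves are rounded down. *)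
Definition half_code : cmd :=
  CWhile 'V 5
    (CWhile (ERight 'V 4)
       (6 ::= ENode ELeaf 'V 6 ;;
        4 ::= ERight (ERight 'V 4)) ;;
     4 ::= 'V 6 ;;
     6 ::= ELeaf ;;
     5 ::= ERight 'V 5)%cmd.

(** The encoding of a fixed yes-instance: two vertices, a single arc of weight 2, parameter 1. *)
Definition yes_expr : expr :=
  let one := ENode (ENode ELeaf ELeaf) ELeaf in
  let two := ENode ELeaf one in
  ENode (ENode (ENode ELeaf (ENode two ELeaf))
               (ENode (ENode ELeaf (ENode ELeaf ELeaf)) ELeaf))
        one.

(** The three leaves put before the [b] digits of the parameter make [half_code] halve [b + 3]
    times, so something is left exactly when the count is at least [8 * 2^b]. *)
Definition kernel_code : cmd :=
  (1 ::= ELeft 'V 0 ;;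
   2 ::= ELeft 'V 0 ;;
   matrix_code ;;
   10 ::= 'V 3 ;; rev_code ;; 3 ::= 'V 11 ;; 11 ::= ELeaf ;;
   5 ::= ENode ELeaf (ENode ELeaf (ENode ELeaf (ERight 'V 0))) ;;
   half_code ;;
   CIf 'V 4 (0 ::= yes_expr) (0 ::= ENode 'V 3 (ERight 'V 0)))%cmd.

(** * Correctness and running time of the program *)

Lemma runs_conv N c l l1 l' n n' :
  runs N c l l1 n -> l1 = l' -> n <= n' -> runs N c l l' n'.
Proof. by move=> r <- le_n; apply: runs_leq r. Qed.

Ltac cost := simpl; lia.

(** Symbolic execution of loop-free code. The final registers and the step count may be existential
    variables, matched afterwards through [runs_conv]; loops are left as goals. *)
Ltac exec :=
  cbn [set_nth eval nth is_node enc_bit]; cbv iota;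
  lazymatch goal with
  | |- runs _ (CSeq _ _) _ _ _ => eapply runs_seq; [exec|exec]
  | |- runs _ (CAssign _ _) _ _ _ => eapply runs_assign; cost
  | |- runs _ (CIf _ _ _) _ _ _ => eapply runs_if; [cost|exec]
  | |- _ => idtac
  end.

Lemma runs_rev N (a0 a1 a2 a3 a4 a5 a6 a7 a8 a9 a11 a12 : tree) (l : seq tree) :
  10 * tsize (enc_seq l) + 10 <= N ->
  runs N rev_code
    [:: a0; a1; a2; a3; a4; a5; a6; a7; a8; a9; enc_seq l; a11; a12]
    [:: a0; a1; a2; a3; a4; a5; a6; a7; a8; a9; Leaf; enc_seq (rev l); a12]
    (3 * size l + 2).
Proof.
move=> le_N; rewrite /rev_code; set loop := CWhile _ _.
(* The sizes of the list and of the accumulator have a constant sum during the loop, so one bound on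
   the cost of an expression serves all rounds. *)
have loopP acc l' : 10 * (tsize (enc_seq l') + tsize (enc_seq acc)) <= N ->
  runs N loop
    [:: a0; a1; a2; a3; a4; a5; a6; a7; a8; a9; enc_seq l'; enc_seq acc; a12]
    [:: a0; a1; a2; a3; a4; a5; a6; a7; a8; a9; Leaf; enc_seq (catrev l' acc); a12]
    (3 * size l' + 1).
  elim: l' acc => [|x l' IH] acc /= le.
    by apply: runs_while_false => //; cost.
  eapply runs_conv.
  - eapply runs_while_true; [cost|by []|exec|].
    by apply: (IH (x :: acc)); cost.
  - by [].
  - lia.
eapply runs_conv.
- eapply runs_seq; first by exec.
  by apply: (loopP [::]); cost.
- by [].
- lia.
Qed.

Definition enc_bits (p : seq bool) : tree := enc_seq [seq enc_bit b | b <- p].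

Lemma runs_neq N (a0 a1 a2 a3 a4 a5 a6 a7 a8 a9 : tree) (p q : seq bool) :
  10 * (tsize (enc_bits p) + tsize (enc_bits q)) + 20 <= N ->
  runs N neq_code
    [:: a0; a1; a2; a3; a4; a5; a6; a7; a8; a9; enc_bits p; enc_bits q; Leaf]
    [:: a0; a1; a2; a3; a4; a5; a6; a7; a8; a9; Leaf; Leaf; enc_bit (p != q)]
    (7 * size p + 4).
Proof.
move=> le_N; rewrite /neq_code; set loop := CWhile _ _.
(* The loop stops at the end of [p], when a longer [q] may not have been noticed yet. Hence only the
   disjunction of the flag with the presence of remaining digits of [q] is determined. *)
have loopP d : exists2 d', runs N loop
    [:: a0; a1; a2; a3; a4; a5; a6; a7; a8; a9; enc_bits p; enc_bits q; enc_bit d]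
    [:: a0; a1; a2; a3; a4; a5; a6; a7; a8; a9; Leaf; enc_bits (drop (size p) q);
        enc_bit d'] (7 * size p + 1)
    & d' || (drop (size p) q != [::]) = d || (p != q).
  elim: p q d le_N => [|b p IH] q d le.
    exists d; last by case: q {le}.
    by rewrite drop0; apply: runs_while_false => //; case: d; cost.
  have [|d' r' e'] := IH (behead q) (d || (ohead q != Some b)).
    by move: le; case: q => [|b' q]; rewrite /enc_bits /=; lia.
  have dropE : drop (size (b :: p)) q = drop (size p) (behead q) by case: (q).
  exists d'; rewrite dropE; last first.
    rewrite e'; case: q {le r' e' dropE} => [|b' q] /=.
      by rewrite !orbT.
    rewrite -orbA; congr orb; rewrite eqseq_cons negb_and eq_sym.
    by rewrite (inj_eq (@Some_inj _)) eq_sym.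
  eapply runs_conv.
  - eapply runs_while_true => //; last exact: r'.
      by move: le; rewrite /enc_bits; case: (b); cost.
    instantiate (1 := 6).
    case: q le {r' e' dropE} => [|[] q]; case: b; case: d => le;
      rewrite /enc_bits /= in le *; (eapply runs_conv; [exec|by []|by []]).
  - by [].
  - by rewrite /=; lia.
have [d' r' e'] := loopP false.
eapply runs_conv.
- eapply runs_seq; first exact: r'.
  instantiate (1 := 3).
  instantiate (1 := [:: a0; a1; a2; a3; a4; a5; a6; a7; a8; a9; Leaf; Leaf;
     enc_bit (d' || (drop (size p) q != [::]))]).
  have le_d : tsize (enc_bits (drop (size p) q)) <= tsize (enc_bits q).
    elim: (size p) (q) => [|m IH] [|b' q'] //; rewrite ?drop0 //.
    by apply: leq_trans (IH q') _; rewrite /enc_bits /=; lia.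
  case: (drop (size p) q) le_d => [|b' q'] le_d; case: (d');
    rewrite /enc_bits /= in le_N le_d *;
    (eapply runs_conv; [exec|by []|by []]).
- by rewrite e'.
- lia.
Qed.

Lemma enc_seq_cons (t : tree) (l : seq tree) :
  enc_seq (t :: l) = Node t (enc_seq l).
Proof. by []. Qed.

Lemma tsize_enc_seq (l : seq tree) :
  tsize (enc_seq l) = (sumn (map tsize l) + size l).+1.
Proof. by elim: l => //= x l ->; lia. Qed.

Lemma tsize_gt0 (t : tree) : 0 < tsize t.
Proof. by case: t. Qed.

Lemma tsize_enc_seq_rev (l : seq tree) :
  tsize (enc_seq (rev l)) = tsize (enc_seq l).
Proof. by rewrite !tsize_enc_seq map_rev sumn_rev size_rev. Qed.

Lemma size_lt_tsize (l : seq tree) : 2 * size l < tsize (enc_seq l).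
Proof. by elim: l => //= x l IH; have := tsize_gt0 x; lia. Qed.

Lemma leq_tsize_enc_seq (T : Type) (F G : T -> tree) (l : seq T) :
  (forall x, tsize (F x) <= tsize (G x)) ->
  tsize (enc_seq (map F l)) <= tsize (enc_seq (map G l)).
Proof. by move=> FG; elim: l => //= x l IH; have := FG x; lia. Qed.

Definition unary (m : nat) : tree := enc_seq (nseq m Leaf).

Lemma unaryS m : unary m.+1 = Node Leaf (unary m).
Proof. by []. Qed.

Lemma tsize_unary m : tsize (unary m) = 2 * m + 1.
Proof. by elim: m => //= m ->; lia. Qed.

Section Matrix.

Variables (T : Type) (W : T -> T -> seq bool).

Definition row_tree (i : T) (js : seq T) : tree :=
  enc_seq [seq enc_bits (W i j) | j <- js].

(** Row [j] cut down to the columns [is_] that are still unprocessed; its head is its entry in the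
    current column. *)
Definition col_tree (is_ : seq T) (j : T) : tree :=
  enc_seq [seq enc_bits (W j i) | i <- is_].

Lemma row_tree_cons i j js :
  row_tree i (j :: js) = Node (enc_bits (W i j)) (row_tree i js).
Proof. by []. Qed.

Lemma col_tree_cons i is_ j :
  col_tree (i :: is_) j = Node (enc_bits (W j i)) (col_tree is_ j).
Proof. by []. Qed.

Definition kept (i j : T) : tree :=
  if W i j != W j i then enc_bits (W i j) else Leaf.

Definition unbalanced (js : seq T) (i : T) : bool :=
  has (fun j => W i j != W j i) js.

Lemma tsize_kept i j : tsize (kept i j) <= tsize (enc_bits (W i j)).
Proof. by rewrite /kept; case: ifP => // _; apply: tsize_gt0. Qed.

Lemma tsize_enc_bit b : tsize (enc_bit b) <= 3.
Proof. by case: b. Qed.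

(** Comparing two entries takes a number of steps linear in the digits of the entry of row [i], so
    the total is linear in the size of that row. *)
Lemma runs_row N (a0 a1 a2 a3 a4 : tree) (i : T) (is_ js : seq T)
    (accR acco : seq tree) (f : bool) :
  30 * (tsize (row_tree i js) + tsize (enc_seq (map (col_tree (i :: is_)) js))
        + tsize (enc_seq accR) + tsize (enc_seq acco)) + 100 <= N ->
  runs N row_code
    [:: a0; a1; a2; a3; a4; row_tree i js;
        enc_seq (map (col_tree (i :: is_)) js); enc_seq accR; enc_seq acco;
        enc_bit f; Leaf; Leaf; Leaf]
    [:: a0; a1; a2; a3; a4; Leaf; Leaf;
        enc_seq (catrev (map (col_tree is_) js) accR);
        enc_seq (catrev (map (kept i) js) acco);
        enc_bit (f || unbalanced js i); Leaf; Leaf; Leaf]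
    (10 * tsize (row_tree i js)).
Proof.
elim: js accR acco f => [|j js IH] accR acco f le.
  rewrite orbF; apply: (@runs_leq _ _ _ _ 1) => //.
  by apply: runs_while_false => //; cost.
have szW := size_lt_tsize [seq enc_bit b | b <- W i j].
rewrite size_map -/(enc_bits _) in szW.
have szf := tsize_enc_bit f; have szk := tsize_kept i j.
pose rest := col_tree is_ j; set cols := enc_seq (map (col_tree (i :: is_)) js).
rewrite row_tree_cons map_cons enc_seq_cons -/cols col_tree_cons -/rest /= in le *.
eapply runs_conv.
- eapply runs_while_true; [cost|by []| |].
    eapply runs_seq; first by exec.
    eapply runs_seq; first by exec.
    eapply runs_seq; first by apply: runs_neq; lia.
    instantiate (2 := [:: a0; a1; a2; a3; a4; row_tree i js;
      cols; enc_seq (rest :: accR);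
      enc_seq (kept i j :: acco); enc_bit (f || (W i j != W j i));
      Leaf; Leaf; Leaf]).
    instantiate (1 := 7).
    rewrite /kept in szk *; case: ifP szk => _ szk.
      by eapply runs_conv; [exec|rewrite /= ?orbT|].
    by eapply runs_conv; [exec|rewrite /= ?orbF|].
  by apply: IH; rewrite -/cols /=; lia.
- by rewrite /unbalanced /= orbA.
- lia.
Qed.

Lemma runs_matrix N (a0 : tree) (is_ js : seq T) (acc : seq tree) (m : nat) :
  100 * (2 * tsize (enc_seq (map (row_tree^~ js) is_))
         + tsize (enc_seq (map (col_tree is_) js))
         + tsize (enc_seq acc) + tsize (unary m)) + 300 <= N ->
  runs N matrix_code
    [:: a0; enc_seq (map (row_tree^~ js) is_); enc_seq (map (col_tree is_) js);
        enc_seq acc; unary m;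
        Leaf; Leaf; Leaf; Leaf; Leaf; Leaf; Leaf; Leaf]
    [:: a0; Leaf; enc_seq (map (col_tree [::]) js);
        enc_seq (catrev [seq enc_seq (map (kept i) js) | i <- is_] acc);
        unary (m + count (unbalanced js) is_);
        Leaf; Leaf; Leaf; Leaf; Leaf; Leaf; Leaf; Leaf]
    (20 * tsize (enc_seq (map (row_tree^~ js) is_))).
Proof.
elim: is_ acc m => [|i is_ IH] acc m le.
  rewrite addn0; apply: (@runs_leq _ _ _ _ 1) => //.
  by apply: runs_while_false => //; cost.
have szr := size_lt_tsize [seq enc_bits (W i j) | j <- js].
rewrite size_map -/(row_tree i js) in szr.
have szk : tsize (enc_seq (map (kept i) js)) <= tsize (row_tree i js).
  by apply: leq_tsize_enc_seq => j; apply: tsize_kept.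
have szc : tsize (enc_seq (map (col_tree is_) js)) <=
    tsize (enc_seq (map (col_tree (i :: is_)) js)).
  by apply: leq_tsize_enc_seq => j; rewrite /col_tree /=; lia.
have szkr := tsize_enc_seq_rev (map (kept i) js).
have szcr := tsize_enc_seq_rev (map (col_tree is_) js).
have szf := tsize_enc_bit (unbalanced js i).
rewrite map_cons enc_seq_cons [tsize (Node _ _)]/= in le *.
eapply runs_conv.
- eapply runs_while_true; [cost|by []| |].
    eapply runs_seq; first by exec.
    eapply runs_seq; first by exec.
    cbn [set_nth eval nth].
    eapply runs_seq.
      by apply: (@runs_row _ _ _ _ _ _ i is_ js [::] [::] false); cost.
    rewrite -!/(rev _) orFb.
    eapply runs_seq; first by exec.
    eapply runs_seq; first by exec.
    cbn [set_nth eval nth].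
    (* The row loop leaves the shortened rows, and likewise the new row, last first; two reversals
       restore their order. *)
    eapply runs_seq; first by apply: runs_rev; lia.
    rewrite revK.
    eapply runs_seq; first by exec.
    eapply runs_seq; first by exec.
    eapply runs_seq; first by exec.
    cbn [set_nth eval nth].
    eapply runs_seq; first by apply: runs_rev; lia.
    rewrite revK.
    instantiate (2 := [:: a0; enc_seq (map (row_tree^~ js) is_);
      enc_seq (map (col_tree is_) js);
      enc_seq (enc_seq (map (kept i) js) :: acc); unary (unbalanced js i + m);
      Leaf; Leaf; Leaf; Leaf; Leaf; Leaf; Leaf; Leaf]).
    instantiate (1 := 6).
    by case: (unbalanced js i) szf => szf; (eapply runs_conv; [exec|by []|by []]).
  apply: IH; rewrite !tsize_unary /= in le *.
  by have := tsize_gt0 (row_tree i js); case: (unbalanced js i); lia.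
- by rewrite /= addnA [m + _]addnC.
- rewrite ?size_rev ?size_map; lia.
Qed.

End Matrix.

Lemma runs_half N (a0 a1 a2 a3 : tree) (m : nat) (ks : seq tree) :
  20 * (tsize (unary m) + tsize (enc_seq ks)) + 100 <= N ->
  runs N half_code
    [:: a0; a1; a2; a3; unary m; enc_seq ks;
        Leaf; Leaf; Leaf; Leaf; Leaf; Leaf; Leaf]
    [:: a0; a1; a2; a3; unary (iter (size ks) half m); Leaf;
        Leaf; Leaf; Leaf; Leaf; Leaf; Leaf; Leaf]
    (size ks * (3 * m + 5) + 1).
Proof.
rewrite /half_code; set loop := CWhile (ERight _) _.
have loopP a5 m' c : 20 * (tsize (unary m') + tsize (unary c)) <= N ->
  runs N loop
    [:: a0; a1; a2; a3; unary m'; a5; unary c;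
        Leaf; Leaf; Leaf; Leaf; Leaf; Leaf]
    [:: a0; a1; a2; a3; unary (odd m'); a5; unary (m'./2 + c);
        Leaf; Leaf; Leaf; Leaf; Leaf; Leaf] (3 * m' + 1).
  rewrite !tsize_unary.
  (* Strong induction, since each round removes two elements. *)
  have [n le_n] := ubnP m'; elim: n => // n IH in m' c le_n *.
  case: m' le_n => [|[|m']] le_n le.
  - by apply: runs_while_false => //; cost.
  - by apply: (@runs_leq _ _ _ _ 1) => //; apply: runs_while_false => //; cost.
  have szm := tsize_unary m'; have szc := tsize_unary c; rewrite !unaryS.
  eapply runs_conv.
  - eapply runs_while_true; [cost|by []|by exec|].
    by apply: (IH m' c.+1); lia.
  - by rewrite /= negbK addnS.
  - lia.
elim: ks m => [|k ks IH] m le.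
  by apply: runs_while_false => //; cost.
rewrite tsize_unary /= in le.
have szm := tsize_unary (odd m); have szc := tsize_unary m./2.
have := odd_double_half m; rewrite -muln2 => mE.
eapply runs_conv.
- eapply runs_while_true; [cost|by []| |].
    eapply runs_seq; first by apply: (@loopP _ m 0); rewrite !tsize_unary; lia.
    rewrite addn0.
    by exec.
  by apply: IH; rewrite tsize_unary; lia.
- by rewrite iterSr.
- have : size ks * (3 * m./2 + 5) <= size ks * (3 * m + 5).
    by rewrite leq_mul2l; lia.
  rewrite [size (_ :: _)]/= mulSn; lia.
Qed.

(** * The kernel *)

Definition matrix_tree (T : Type) (W : T -> T -> seq bool) (vs : seq T) : tree :=
  enc_seq (map (row_tree W ^~ vs) vs).

Lemma runs_kernel (T : Type) (W : T -> T -> seq bool) (vs : seq T)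
    (k : seq bool) (S := tsize (Node (matrix_tree W vs) (enc_bits k))) :
  exists2 l', runs (2000 * S) kernel_code
      (Node (matrix_tree W vs) (enc_bits k) :: nseq 12 Leaf) l' (100 * (S * S))
    & nth Leaf l' 0 =
      if 0 < iter (size k + 3) half (count (unbalanced W vs) vs)
      then eval (fun=> Leaf) yes_expr
      else Node (enc_seq [seq enc_seq (map (kept W i) vs) | i <- vs]) (enc_bits k).
Proof.
have szv := size_lt_tsize (map (row_tree W ^~ vs) vs).
rewrite size_map -/(matrix_tree W vs) in szv.
have szk := size_lt_tsize [seq enc_bit b | b <- k].
rewrite size_map -/(enc_bits k) in szk.
have n_le := count_size (unbalanced W vs) vs.
have szo : tsize (enc_seq [seq enc_seq (map (kept W i) vs) | i <- vs]) <=
    tsize (matrix_tree W vs).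
  apply: leq_tsize_enc_seq => i; apply: leq_tsize_enc_seq => j.
  exact: tsize_kept.
have szor := tsize_enc_seq_rev [seq enc_seq (map (kept W i) vs) | i <- vs].
have SE : S = (tsize (matrix_tree W vs) + tsize (enc_bits k)).+1 by [].
clearbody S.
set n := count _ _ in n_le *; set out := enc_seq (map (fun i => _) vs) in szo szor *.
set res := if _ then _ else _.
pose hs := iter (size k + 3) half n.
have hs_le : hs <= n.
  by rewrite /hs; elim: (size k + 3) => //= m; lia.
have szh := tsize_unary hs.
exists [:: res; Leaf; enc_seq (map (col_tree W [::]) vs); out; unary hs;
  Leaf; Leaf; Leaf; Leaf; Leaf; Leaf; Leaf; Leaf] => //.
rewrite /kernel_code; eapply runs_conv.
- eapply runs_seq; first by exec.
  eapply runs_seq; first by exec.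
  cbn [set_nth eval nth nseq ncons iter].
  eapply runs_seq.
    by apply: (@runs_matrix T W _ _ vs vs [::] 0); rewrite -!/(matrix_tree W vs); cost.
  rewrite add0n -/n -/(rev _).
  eapply runs_seq; first by exec.
  cbn [set_nth eval nth].
  eapply runs_seq; first by apply: runs_rev; lia.
  rewrite revK -/out.
  eapply runs_seq; first by exec.
  eapply runs_seq; first by exec.
  eapply runs_seq; first by exec.
  cbn [set_nth eval nth].
  eapply runs_seq.
    apply: (@runs_half _ _ _ _ _ n
      [:: Leaf, Leaf, Leaf & [seq enc_bit b | b <- k]]).
    by rewrite tsize_unary /= -/(enc_bits k); lia.
  rewrite [size _]/= size_map -[(size k).+3]addn3 -/hs.
  instantiate (2 := [:: res; Leaf; enc_seq (map (col_tree W [::]) vs); out; unary hs;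
    Leaf; Leaf; Leaf; Leaf; Leaf; Leaf; Leaf; Leaf]).
  instantiate (1 := 2).
  rewrite /res -/hs; case: hs szh hs_le {res} => [|h] szh hs_le.
    rewrite -[unary 0]/Leaf.
    by eapply runs_conv; [exec|by []|by []].
  rewrite unaryS /= in szh *.
  by eapply runs_conv; [exec|by []|by []].
- by [].
(* The halving phase has [size k + 3 <= 4 * S] rounds of at most [3 * n + 5 <= 8 * S] steps each. *)
- have half_steps : (size k).+3 * (3 * n + 5) <= 32 * (S * S).
    by rewrite -[32]/(4 * 8) mulnACA leq_mul; lia.
  have S_le : S <= S * S by rewrite leq_pmulr; lia.
  rewrite [size (Leaf :: _)]/= ?size_rev ?size_map -/(matrix_tree W vs); lia.
Qed.

(** * Repeated halving and binary digits *)

Lemma iter_half_gt0 (m n : nat) : (0 < iter m half n) = (2 ^ m <= n).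
Proof.
elim: m n => [|m IH] n; first by rewrite expn0.
by rewrite iterSr IH expnS; lia.
Qed.

Lemma expn_size_pos_bits (p : BinNums.positive) :
  nat_of_pos p < 2 ^ size (pos_bits p) <= 2 * nat_of_pos p.
Proof. by elim: p => //= p IH; rewrite expnS NatTrec.doubleE; lia. Qed.

Lemma expn_size_nat_bits (n : nat) :
  0 < n -> n < 2 ^ size (nat_bits n) <= 2 * n.
Proof.
rewrite /nat_bits; have := bin_of_natK n.
by case: (bin_of_nat n) => [<-|p <-] //= _; apply: expn_size_pos_bits.
Qed.

(** Justifies comparing weights through their digit lists, as the program does. *)
Lemma nat_bits_inj : injective nat_bits.
Proof.
move=> m n; rewrite /nat_bits => mn; apply: (can_inj bin_of_natK); move: mn.
have pos_inj : injective pos_bits.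
  elim=> [p IH|p IH|] [q|q|] //= [].
  - by move/IH->.
  - by case: p {IH}.
  - by move/IH->.
  - by case: q.
by case: (bin_of_nat m) (bin_of_nat n) => [|[p|p|]] [|[q|q|]] //;
   move=> /pos_inj ->.
Qed.

(** * Deleting pairs of opposite arcs of equal weight *)

Lemma reduced_loopless (D : wdigraph) (i : 'I_(nvert D)) :
  (i, i) \notin [set a in arcs D | arc_weight a.1 a.2 != arc_weight a.2 a.1].
Proof. by rewrite inE (negPf (arcs_loopless i)). Qed.

Lemma reduced_weight_gt0 (D : wdigraph) (a : 'I_(nvert D) * 'I_(nvert D)) :
  a \in [set a in arcs D | arc_weight a.1 a.2 != arc_weight a.2 a.1] ->
  0 < weight a.
Proof. by rewrite inE => /andP[/weight_gt0]. Qed.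

Definition reduced (D : wdigraph) : wdigraph :=
  WDigraph (@reduced_loopless D) (@reduced_weight_gt0 D).

Lemma reduced_arc_weight (D : wdigraph) (i j : 'I_(nvert D)) :
  @arc_weight (reduced D) i j =
  if arc_weight i j != arc_weight j i then arc_weight i j else 0.
Proof.
rewrite [LHS]/arc_weight /= inE /=.
by case: (_ != _); rewrite ?andbF ?andbT.
Qed.

Lemma reduced_net (D : wdigraph) (i j : 'I_(nvert D)) :
  @net (reduced D) i j = net i j.
Proof.
rewrite /net !reduced_arc_weight [_ j i == _]eq_sym.
by case: eqVneq => //=; lia.
Qed.

Lemma eq_surplus (T : eqType) (s s' : T -> T -> int) (l : seq T) :
  s =2 s' -> surplus s l = surplus s' l.
Proof.
by move=> ss; elim: l => //= x l ->; congr (_ + _)%R; apply: eq_bigr => y _.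
Qed.

Definition active_vertices (D : wdigraph) : nat :=
  count (active (@net D) (enum 'I_(nvert D))) (enum 'I_(nvert D)).

Lemma net_neq0 (D : wdigraph) (i j : 'I_(nvert D)) :
  (net i j != 0%R) = (arc_weight i j != arc_weight j i).
Proof. by rewrite /net subr_eq0. Qed.

(** A surviving arc has nonzero [net], so both its ends are active, and the arcs lie in the square
    of the set of active vertices. *)
Lemma card_reduced_arcs (D : wdigraph) :
  #|arcs (reduced D)| <= active_vertices D ^ 2.
Proof.
pose A := [set i | active (@net D) (enum 'I_(nvert D)) i].
have -> : active_vertices D = #|A|.
  rewrite /active_vertices -size_filter.
  rewrite -(card_uniqP (filter_uniq _ (enum_uniq 'I_(nvert D)))).
  by apply: eq_card => i; rewrite inE mem_filter mem_enum andbT.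
rewrite -mulnn -cardsX; apply/subset_leq_card/subsetP => -[i j].
rewrite !inE /= -net_neq0 => /andP[_ ij].
apply/andP; split; apply/hasP; [exists j|exists i]; rewrite ?mem_enum //.
by rewrite net_anti oppr_eq0.
Qed.

Definition yes_graph_arcs : {set 'I_2 * 'I_2} := [set (ord0, ord_max)].

Lemma yes_graph_loopless (i : 'I_2) : (i, i) \notin yes_graph_arcs.
Proof. by rewrite inE; case: i => -[|[|i]]. Qed.

(** The order along the arc has surplus 2, exactly what the parameter 1 demands. *)
Definition yes_graph : wdigraph :=
  @WDigraph 2 yes_graph_arcs (fun=> 2) yes_graph_loopless (fun _ _ => isT).

Definition yes_example : instance := @Instance yes_graph 1 isT.

Lemma enum_ord2 : enum 'I_2 = [:: ord0; ord_max].
Proof. by apply: (inj_map val_inj); rewrite val_enum_ord. Qed.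

Lemma enc_yes_example : enc_instance yes_example = eval (fun=> Leaf) yes_expr.
Proof.
by rewrite /enc_instance /enc_graph /= enum_ord2 /= /yes_graph_arcs !inE.
Qed.

Lemma yes_exampleP : yes_instance yes_example.
Proof.
apply/yes_instanceP; exists [:: ord0; ord_max]; first by rewrite enum_ord2.
by rewrite /= !big_cons !big_nil /net /arc_weight /= /yes_graph_arcs !inE.
Qed.

(** * The kernelization map and its properties *)

Definition kernel (I : instance) : instance :=
  if 2 ^ (size (nat_bits (param I)) + 3) <= active_vertices (graph I)
  then yes_example else @Instance (reduced (graph I)) (param I) (param_gt0 I).

Lemma kernel_equivalent (I : instance) : equivalent I (kernel I).
Proof.
have /andP[k_lt k_le] := expn_size_nat_bits (param_gt0 I).
rewrite /equivalent /kernel; case: ifP => [big|_].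
  split=> _; first exact: yes_exampleP.
  apply/yes_instanceP.
  have [l pl le_l] := surplus_active (@net_anti (graph I)) (enum 'I_(nvert (graph I))).
  (* At least [8 * 2^b] active vertices give a surplus of at least [2 * 2^b], which exceeds
     [2 * k]. *)
  exists l => //; move: big le_l; rewrite -/(active_vertices _) expnD; lia.
by split=> /yes_instanceP[l pl le_l]; apply/yes_instanceP; exists l => //;
   rewrite (eq_surplus _ (@reduced_net (graph I))) in le_l *.
Qed.

Lemma param_kernel (I : instance) : param (kernel I) <= param I.
Proof. by rewrite /kernel; case: ifP => // _; apply: param_gt0. Qed.

Lemma card_kernel_arcs (I : instance) :
  #|arcs (graph (kernel I))| <= 256 * param I ^ 2.
Proof.
have k0 := param_gt0 I; have /andP[k_lt k_le] := expn_size_nat_bits k0.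
rewrite /kernel; case: ifP => [_|/negbT].
  by rewrite /= /yes_graph_arcs cards1; nia.
rewrite -ltnNge expnD => small /=.
apply: leq_trans (card_reduced_arcs _) _.
(* There are fewer than [8 * 2^b <= 16 * k] active vertices. *)
by rewrite -[256]/(16 ^ 2) -expnMn leq_exp2r //; lia.
Qed.

Lemma kernel_poly_time : poly_time kernel.
Proof.
(* At most [100 * S^2] expressions are evaluated, each at cost at most [2000 * S], for an input of
   size [S]. *)
exists kernel_code, (100 * 2000), 3 => I.
pose W (i j : 'I_(nvert (graph I))) := nat_bits (arc_weight i j).
have encE : enc_instance I =
    Node (matrix_tree W (enum 'I_(nvert (graph I)))) (enc_bits (nat_bits (param I))).
  by [].
have WE i j : (W i j != W j i) = (arc_weight i j != arc_weight j i).
  by rewrite (inj_eq nat_bits_inj).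
have [l' r res] := runs_kernel W (enum 'I_(nvert (graph I))) (nat_bits (param I)).
rewrite -encE in r.
have [|s [t [ex sl le_t]]] := r (init_store (enc_instance I)).
  (* The initial store is the input followed by twelve explicit leaves, which gives the thirteen
     registers of the program. *)
  case=> // x; rewrite -[RHS]/(nth Leaf (nseq 12 Leaf) x) nth_nseq.
  by case: ifP.
exists s, t; split=> //.
  rewrite sl res iter_half_gt0 /kernel.
  have -> : count (unbalanced W (enum 'I_(nvert (graph I)))) (enum 'I_(nvert (graph I)))
      = active_vertices (graph I).
    by apply: eq_count => i; apply: eq_has => j; rewrite WE net_neq0.
  case: ifP => _; first by rewrite enc_yes_example.
  rewrite /enc_instance /enc_graph /=; congr (Node (enc_seq _) _).
  apply: eq_map => i; congr enc_seq; apply: eq_map => j.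
  rewrite -/(@arc_weight (reduced (graph I)) i j) reduced_arc_weight /kept WE.
  by case: ifP.
apply: leq_trans le_t _; move: (tsize _) => S.
have -> : 100 * (S * S) * (2000 * S) = 100 * 2000 * S ^ 3.
  by rewrite mulnACA mulnn -expnSr.
exact: leq_addr.
Qed.

Theorem theorem1 :
  exists f : instance -> instance,
    [/\ poly_time f,
        forall I : instance, equivalent I (f I),
        forall I : instance, param (f I) <= param I
      & exists C : nat, forall I : instance,
          #|arcs (graph (f I))| <= C * param I ^ 2].
Proof.
exists kernel; split.
- exact: kernel_poly_time.
- exact: kernel_equivalent.
- exact: param_kernel.
- by exists 256 => I; apply: card_kernel_arcs.
Qed.
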